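(* Let $\mathbb{F}$ be a field of characteristic different from $2$ and let $a,a'\in\mathbb{F}$ with $a\neq a'$. Then $C_a\sim C_{a'}$ if and only if $2a+1\in(\mathbb{F}^\times)^2$ and $a'=-\frac{a}{2a+1}$, where $$C_{b}=\begin{pmatrix}0&0&0&0\\ 0&0&0&0\\ 1&1&0&0\\ b&0&1&0\end{pmatrix}\quad(b\in\mathbb{F}).$$
   Context: $(\mathbb{F}^\times)^2$ denotes the set of nonzero squares in $\mathbb{F}$. For a strictly lower triangular $n\times n$ matrix $T=[t_{ij}]$ ($n\geq 2$) over a field $\mathbb{F}$ of characteristic different from $2$, $\mathcal{A}(T)$ is the commutative (unital, associative) $\mathbb{F}$-algebra given by generators $X_1,\dots,X_n$ and relations $X_1^2=0$ and $X_i^2=\sum_{j<i}t_{ij}X_jX_i$ for $2\leq i\leq n$; it is graded by $\deg(X_i)=2$. For two such $n\times n$ matrices write $T\sim S$ if there is a degree preserving isomorphism of graded $\mathbb{F}$-algebras $\mathcal{A}(T)\to\mathcal{A}(S)$. *)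

(* Defs.v *)
From HB Require Import structures.
From mathcomp Require Import all_boot all_algebra.
From mathcomp Require Import mpoly boolp.

Set Implicit Arguments.
Unset Strict Implicit.
Unset Printing Implicit Defensive.

Import GRing.Theory.

Local Open Scope ring_scope.
Local Open Scope quotient_scope.

Section Presentation.
Variables (F : fieldType) (n : nat).
Implicit Types (T : 'M[F]_n) (p q : {mpoly F[n]}).

(* X_i^2 - \sum_(j < i) t_ij X_j X_i; for the first index the sum is empty, so
   this is the relation X_1^2 = 0. *)
Definition relator T (i : 'I_n) : {mpoly F[n]} :=
  'X_i ^+ 2 - \sum_(j < n | (j < i)%N) T i j *: ('X_j * 'X_i).

Definition in_relator_ideal T p : Prop :=
  exists c : 'I_n -> {mpoly F[n]}, p = \sum_(i < n) c i * relator T i.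

Definition relator_ideal T p : bool := `[< in_relator_ideal T p >].

Lemma relator_idealP T p : reflect (in_relator_ideal T p) (p \in relator_ideal T).
Proof. exact: asboolP. Qed.

Lemma relator_mcoeff0 T i : (relator T i)@_0%MM = 0.
Proof.
have mX j k : ('X_j * 'X_k : {mpoly F[n]})@_0%MM = 0.
  by rewrite -mpolyXD mcoeffX -mdeg_eq0 mdegD !mdeg1.
rewrite /relator mcoeffB expr2 mX raddf_sum /= big1 ?subr0 // => j _.
by rewrite mcoeffZ mX mulr0.
Qed.

Lemma relator_ideal_closed T : idealr_closed (relator_ideal T).
Proof.
split.
- by apply/relator_idealP; exists (fun=> 0); rewrite big1 // => i _; rewrite mul0r.
- apply/relator_idealP => -[c /(congr1 (mcoeff 0%MM))].
  rewrite mcoeff1 eqxx raddf_sum /= big1; last first.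
    by move=> i _; rewrite rmorphM /= relator_mcoeff0 mulr0.
  by move/eqP; rewrite oner_eq0.
- move=> u p q /relator_idealP[c ->] /relator_idealP[d ->].
  apply/relator_idealP; exists (fun i => u * c i + d i).
  rewrite mulr_sumr -big_split /=; apply: eq_bigr => i _.
  by rewrite mulrDl mulrA.
Qed.

HB.instance Definition _ T :=
  isIdealr.Build {mpoly F[n]} (relator_ideal T) (relator_ideal_closed T).

Definition relator_idealr T : idealr {mpoly F[n]} := relator_ideal T.

Definition presAlg T : Type := {ideal_quot relator_idealr T}.

HB.instance Definition _ T := GRing.ComNzRing.on (presAlg T).

Definition presAlg_pi T : {mpoly F[n]} -> presAlg T := \pi_{ideal_quot relator_idealr T}.

HB.instance Definition _ T := GRing.RMorphism.on (@presAlg_pi T).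

Definition presAlg_scale T (a : F) (x : presAlg T) : presAlg T := presAlg_pi T a%:MP * x.

Section Lalgebra.
Variable T : 'M[F]_n.

Fact presAlg_scaleA a b (x : presAlg T) :
  presAlg_scale a (presAlg_scale b x) = presAlg_scale (a * b) x.
Proof. by rewrite /presAlg_scale mulrA -rmorphM -mpolyCM. Qed.

Fact presAlg_scale1 : left_id 1 (@presAlg_scale T).
Proof. by move=> x; rewrite /presAlg_scale mpolyC1 rmorph1 mul1r. Qed.

Fact presAlg_scaleDr : right_distributive (@presAlg_scale T) +%R.
Proof. by move=> a x y; rewrite /presAlg_scale mulrDr. Qed.

Fact presAlg_scaleDl (x : presAlg T) :
  {morph (@presAlg_scale T)^~ x : a b / a + b}.
Proof. by move=> a b; rewrite /presAlg_scale mpolyCD rmorphD mulrDl. Qed.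

HB.instance Definition _ := GRing.Zmodule_isLmodule.Build F (presAlg T)
  presAlg_scaleA presAlg_scale1 presAlg_scaleDr presAlg_scaleDl.

Fact presAlg_scaleAl (a : F) (x y : presAlg T) : a *: (x * y) = (a *: x) * y.
Proof. exact: mulrA. Qed.

HB.instance Definition _ :=
  GRing.Lmodule_isLalgebra.Build F (presAlg T) presAlg_scaleAl.

Fact presAlg_scaleAr (a : F) (x y : presAlg T) : a *: (x * y) = x * (a *: y).
Proof. by rewrite [x * y]mulrC presAlg_scaleAl mulrC. Qed.

HB.instance Definition _ :=
  GRing.Lalgebra_isAlgebra.Build F (presAlg T) presAlg_scaleAr.

End Lalgebra.

(* Each generator has degree 2, hence the degree of a monomial m is twice the
   number mdeg m of its factors. *)
Definition in_degree T (d : nat) (x : presAlg T) : Prop :=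
  exists2 p : {mpoly F[n]},
    (forall m, m \in msupp p -> (2 * mdeg m)%N = d) & x = presAlg_pi T p.

Definition graded_iso T S (f : {lrmorphism presAlg T -> presAlg S}) : Prop :=
  bijective f /\ forall d x, in_degree d (f x) <-> in_degree d x.

Definition presAlg_equiv T S : Prop :=
  exists f : {lrmorphism presAlg T -> presAlg S}, graded_iso f.

End Presentation.

Definition nonzero_square (F : fieldType) (x : F) : Prop :=
  exists2 y : F, y != 0 & x = y ^+ 2.

Definition matrixC (F : fieldType) (b : F) : 'M[F]_4 :=
  \matrix_(i < 4, j < 4)
    nth 0 (nth [::] [:: [:: 0; 0; 0; 0];
                        [:: 0; 0; 0; 0];
                        [:: 1; 1; 0; 0];
                        [:: b; 0; 1; 0]] i) j.

Lemma matrixC_strict_lower (F : fieldType) (b : F) (i j : 'I_4) :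
  (i <= j)%N -> matrixC b i j = 0.
Proof. by rewrite mxE; case: i j => [[|[|[|[|i]]]] hi] [[|[|[|[|j]]]] hj]. Qed.

(* Main.v *)
(* A graded isomorphism is a linear substitution of the generators that carries
   the quadratic relations of the source into those of the target, which is a
   system of equations in the entries M i j of its matrix. The only elements of
   degree 2 of square zero in A(C_a) are the multiples of X_1 and of X_2, so
   these two lines are fixed or exchanged, say f(X_1 + X_2) = al X_1 + be X_2.
   The third relation gives f(X_3) = ((al - c) X_1 + (be - c) X_2) / 2 + c X_3
   with c^2 = al be. With w = a f(X_1) + f(X_3), the fourth relation amounts to
   w_1 w_2 = 0, z^2 = c (c + 2 w_2) and a' (c + 2 w_2) = w_1 - w_2, where z is the
   coefficient of X_4 in f(X_4). Of the four resulting cases two give a' = a, and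
   the other two give the stated condition. *)
Require Import Defs.
From HB Require Import structures.
From mathcomp Require Import all_boot all_algebra.
From mathcomp Require Import mpoly boolp ring.

Import GRing.Theory.
Local Open Scope ring_scope.
Local Open Scope quotient_scope.

Section QuadraticPart.
Set Implicit Arguments.
Unset Strict Implicit.
Unset Printing Implicit Defensive.
Variables (F : fieldType) (n : nat).
Implicit Types (T S M N : 'M[F]_n) (p q : {mpoly F[n]}) (u v : 'I_n -> F).

(** * Kernel of the quotient map *)

Lemma presAlg_pi_eq0 T p : presAlg_pi T p = 0 <-> in_relator_ideal T p.
Proof.
rewrite -(rmorph0 (presAlg_pi T)).
split=> [/eqP|h]; last apply/eqP.
  by rewrite /presAlg_pi -Quotient.idealrBE subr0 => /relator_idealP.
by rewrite /presAlg_pi -Quotient.idealrBE subr0; apply/relator_idealP.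
Qed.

Lemma presAlg_pi_surj T (x : presAlg T) : exists p, x = presAlg_pi T p.
Proof. by exists (repr x); rewrite /presAlg_pi reprK. Qed.

Lemma presAlg_piZ T c p : presAlg_pi T (c *: p) = c *: presAlg_pi T p.
Proof. by rewrite -mul_mpolyC rmorphM. Qed.

(** * Low-degree coefficients of elements of the ideal *)

Lemma eq_mnmUD (i j k l : 'I_n) :
  ((U_(k) + U_(l))%MM == (U_(i) + U_(j))%MM) =
  ((k == i) && (l == j)) || ((k == j) && (l == i)).
Proof.
have UI (a b c : 'I_n) : ((U_(a) + U_(b))%MM == (U_(a) + U_(c))%MM) = (b == c).
  by rewrite -eq_mnm1; apply/eqP/eqP=> [|->] //; exact: addmI.
case: (eqVneq k i) => [->|ne_ki] /=.
  rewrite UI; case: eqP => //= ne_lj; apply/esym/negbTE/negP => /andP[/eqP ij /eqP li].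
  by rewrite li in ne_lj.
case: (eqVneq k j) => [->|ne_kj] /=; first by rewrite [X in _ == X]addmC UI.
apply/eqP=> /mnmP/(_ k); rewrite !mnmDE !mnm1E eqxx.
by rewrite [i == k]eq_sym [j == k]eq_sym (negbTE ne_ki) (negbTE ne_kj).
Qed.

Lemma mdeg2P (m : 'X_{1..n}) :
  mdeg m = 2%N -> exists i j : 'I_n, (i <= j)%N /\ m = (U_(i) + U_(j))%MM.
Proof.
move=> m2.
have [i mi] : exists i, m i != 0%N.
  apply/existsP; apply: contraT; rewrite negb_exists => /forallP m0.
  by move: m2; rewrite mdegE big1 // => i _; apply/eqP; rewrite -[_ == _]negbK.
have dm : m = (U_(i) + (m - U_(i)))%MM.
  rewrite addmC submK //; apply/mnm_lepP=> k; rewrite mnm1E.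
  by case: eqP => // <-; rewrite lt0n.
have /eqP/mdeg1P[j /eqP dj] : mdeg (m - U_(i))%MM = 1%N.
  by move: m2; rewrite {1}dm mdegD mdeg1 => -[].
rewrite dj in dm; rewrite dm.
by case: (leqP i j) => [le_ij|/ltnW le_ji]; [exists i, j | exists j, i; rewrite addmC].
Qed.

Lemma homog_mcoeff0 d p m : p \is d.-homog -> mdeg m != d -> p@_m = 0.
Proof. exact: dhomog_nemf_coeff. Qed.

(** Every nonconstant monomial of [c] lifts [p] to a degree above [d], so only the constant term of
    [c] contributes. *)
Lemma mcoeffMhomog d c p (m : 'X_{1..n}) :
  p \is d.-homog -> (mdeg m <= d)%N -> (c * p)@_m = c@_0%MM * p@_m.
Proof.
move=> p_d le_md; rewrite [c in LHS]mpolyE mulr_suml raddf_sum /=.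
have [c0|c0] := boolP (0%MM \in msupp c).
  rewrite (bigD1_seq 0%MM) //= mpolyX0 -scalerAl mul1r mcoeffZ big1 ?addr0 //.
  move=> k k0; rewrite -scalerAl mcoeffZ.
  rewrite (@homog_mcoeff0 (mdeg k + d) ('X_[k] * p)) ?mulr0 //.
    by apply: dhomogM => //; rewrite dhomogX.
  rewrite neq_ltn; apply/orP; left; apply: leq_ltn_trans le_md _.
  by rewrite -[X in (X < _)%N]add0n ltn_add2r lt0n mdeg_eq0.
rewrite (memN_msupp_eq0 c0) mul0r big_seq big1 // => k kc.
rewrite -scalerAl mcoeffZ (@homog_mcoeff0 (mdeg k + d) ('X_[k] * p)) ?mulr0 //.
  by apply: dhomogM => //; rewrite dhomogX.
rewrite neq_ltn; apply/orP; left; apply: leq_ltn_trans le_md _.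
rewrite -[X in (X < _)%N]add0n ltn_add2r lt0n mdeg_eq0.
by apply: contraNneq c0 => <-.
Qed.

Lemma relator_homog T i : relator T i \is 2.-homog.
Proof.
rewrite /relator expr2 rpredB ?rpred_sum // => [|j _].
  by rewrite (@dhomogM _ _ _ 1 _ 1 _) ?dhomogX /= ?mdeg1.
by rewrite rpredZ // (@dhomogM _ _ _ 1 _ 1 _) ?dhomogX /= ?mdeg1.
Qed.

Lemma relator_mcoeff T (i j k : 'I_n) : (i <= j)%N ->
  (relator T k)@_(U_(i) + U_(j)) =
  (k == j)%:R * (if i == j then 1 else - T j i).
Proof.
move=> le_ij; rewrite /relator mcoeffB expr2 -mpolyXD mcoeffX raddf_sum /=.
under eq_bigr => l _ do rewrite mcoeffZ -mpolyXD mcoeffX.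
rewrite !eq_mnmUD; case: (eqVneq i j) => [<-|ne_ij].
  rewrite orbb andbb big1 ?subr0 ?mulr1 // => l lt_lk.
  rewrite eq_mnmUD orbb; case: eqP => [li|_]; rewrite ?mulr0 //=.
  by case: eqP => [ki|_]; rewrite ?mulr0 //; rewrite li ki ltnn in lt_lk.
have lt_ij : (i < j)%N by rewrite ltn_neqAle le_ij andbT; apply: contraNneq ne_ij => /val_inj->.
have -> : ((k == i) && (k == j) || (k == j) && (k == i)) = false.
  by case: (eqVneq k i) => [->|_]; rewrite ?(negbTE ne_ij) ?andbF.
rewrite sub0r; case: (eqVneq k j) => [->|ne_kj].
  rewrite (bigD1 i) //= eq_mnmUD !eqxx mulr1 big1 ?addr0 ?mul1r // => l /andP[_ ne_li].
  rewrite eq_mnmUD (negbTE ne_li) /= [j == i]eq_sym (negbTE ne_ij).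
  by rewrite andbF mulr0.
rewrite big1 ?oppr0 ?mul0r // => l lt_lk.
rewrite eq_mnmUD (negbTE ne_kj) andbF /=.
case: eqP => [lj|_]; case: eqP => [ki|_]; rewrite ?mulr0 //.
by move: lt_lk; rewrite lj ki ltnNge le_ij.
Qed.

(* In the quotient [X_j ^+ 2] is rewritten into the products [X_i * X_j] with
   [i < j], which form a basis of the quadratic part: [qcoef T i j] is the
   coordinate on [X_i * X_j]. *)
Definition qcoef T (i j : 'I_n) p : F :=
  p@_(U_(i) + U_(j)) + T j i * p@_(U_(j) + U_(j)).

Lemma mdeg_U2 (i j : 'I_n) : mdeg (U_(i) + U_(j)) = 2%N.
Proof. by rewrite mdegD !mdeg1. Qed.

(** In degree two only the constant terms of the multipliers count, and every relator has all its
    [qcoef] zero. Conversely, a quadratic form with zero coordinates is the sum of the relators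
    weighted by its own coefficients at the squares. *)
Lemma qcoef_relator_ideal T p : p \is 2.-homog ->
  in_relator_ideal T p <-> (forall i j : 'I_n, (i < j)%N -> qcoef T i j p = 0).
Proof.
move=> p2; split=> [[c ->] i j lt_ij | p0].
  rewrite /qcoef !raddf_sum /= mulr_sumr -big_split big1 //= => k _.
  rewrite !(@mcoeffMhomog 2) ?relator_homog ?mdeg_U2 //.
  rewrite !relator_mcoeff ?(ltnW lt_ij) // eqxx.
  case: (eqVneq i j) => [eq_ij|_]; first by rewrite eq_ij ltnn in lt_ij.
  by ring.
exists (fun i => (p@_(U_(i) + U_(i)))%:MP); apply/mpolyP=> m.
rewrite raddf_sum /=; under eq_bigr => k _ do rewrite mcoeffCM.
case: (eqVneq (mdeg m) 2%N) => [/mdeg2P[i [j [le_ij ->]]]|m2]; last first.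
  rewrite (homog_mcoeff0 p2) // big1 // => k _.
  by rewrite (homog_mcoeff0 (relator_homog T k)) ?mulr0.
under eq_bigr => k _ do rewrite relator_mcoeff //.
rewrite (bigD1 j) //= big1 ?addr0 => [|k /negbTE->]; last by rewrite mul0r mulr0.
rewrite eqxx; case: (eqVneq i j) => [->|ne_ij]; first by rewrite !mulr1.
have /p0/eqP : (i < j)%N.
  by rewrite ltn_neqAle le_ij andbT; apply: contraNneq ne_ij => /val_inj->.
by rewrite /qcoef addr_eq0 => /eqP->; rewrite mul1r mulrN mulrC.
Qed.

(** The ideal starts in degree two; hence linear forms embed in the quotient. *)
Lemma relator_ideal_mcoeff1 T p i : in_relator_ideal T p -> p@_U_(i) = 0.
Proof.
case=> c ->; rewrite raddf_sum big1 //= => k _.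
rewrite (@mcoeffMhomog 2) ?relator_homog ?mdeg1 //.
by rewrite (homog_mcoeff0 (relator_homog T k)) ?mulr0 //= mdeg1.
Qed.

(** * Linear forms and linear substitutions *)

Definition lform u : {mpoly F[n]} := \sum_k u k *: 'X_k.

Lemma lform_homog u : lform u \is 1.-homog.
Proof. by rewrite rpred_sum // => k _; rewrite rpredZ // dhomogX /= mdeg1. Qed.

Lemma lform_mcoeff u i : (lform u)@_U_(i) = u i.
Proof.
rewrite raddf_sum /= (bigD1 i) //= mcoeffZ mcoeffXU eqxx mulr1 big1 ?addr0 // => k.
by move/negbTE; rewrite mcoeffZ mcoeffXU => ->; rewrite mulr0.
Qed.

Lemma lformM_mcoeff u v (i j : 'I_n) :
  (lform u * lform v)@_(U_(i) + U_(j)) =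
  if i == j then u i * v i else u i * v j + u j * v i.
Proof.
have -> : (lform u * lform v)@_(U_(i) + U_(j)) =
    \sum_k \sum_l u k * v l * (((k == i) && (l == j)) || ((k == j) && (l == i)))%:R.
  rewrite mulr_suml raddf_sum /=; apply: eq_bigr => k _.
  rewrite mulr_sumr raddf_sum /=; apply: eq_bigr => l _.
  by rewrite -scalerAl -scalerAr scalerA mcoeffZ -mpolyXD mcoeffX eq_mnmUD.
have sum1 a b : \sum_k \sum_l u k * v l * ((k == a) && (l == b))%:R = u a * v b.
  rewrite (bigD1 a) //= (bigD1 b) //= !eqxx mulr1 !big1 ?addr0 // => k /negbTE ka.
    by rewrite big1 // => l _; rewrite ka mulr0.
  by rewrite ka mulr0.
case: (eqVneq i j) => [<-|ne_ij].
  by under eq_bigr => k _ do under eq_bigr => l _ do rewrite orbb; exact: sum1.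
rewrite -!sum1 -big_split; apply: eq_bigr => k _.
rewrite -big_split; apply: eq_bigr => l _ /=; rewrite -mulrDr -natrD; congr (_ * _%:R).
case: (eqVneq k i) => [->|]; case: (eqVneq l j) => [->|] //=; rewrite ?andbT ?andbF ?addn0 //.
by rewrite (negbTE ne_ij).
Qed.

Lemma homog1_lform p : p \is 1.-homog -> p = lform (fun i => p@_U_(i)).
Proof.
move=> p1; apply/mpolyP=> m.
have [/eqP/mdeg1P[i /eqP->]|m1] := eqVneq (mdeg m) 1%N; first by rewrite lform_mcoeff.
by rewrite (homog_mcoeff0 p1) // (homog_mcoeff0 (lform_homog _)).
Qed.

Definition lsubst M : n.-tuple {mpoly F[n]} := [tuple lform (M i) | i < n].

Lemma comp_lform u M : lform u \mPo lsubst M = lform ((\row_i u i *m M) 0).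
Proof.
rewrite /lform raddf_sum /=.
under eq_bigr => k _ do rewrite comp_mpolyZ comp_mpolyXU -tnth_nth tnth_mktuple.
under eq_bigr => k _ do rewrite /lform scaler_sumr.
rewrite exchange_big; apply: eq_bigr => l _ /=.
rewrite mxE scaler_suml; apply: eq_bigr => k _.
by rewrite scalerA mxE.
Qed.

(* [X_i |-> \sum_k M i k X_k] respects the relations of [T] modulo those of
   [S], in the coordinates [qcoef S]. *)
Definition lin_morph T S M : Prop :=
  forall i p q : 'I_n, (p < q)%N ->
  2 * M i p * M i q + S q p * M i q ^+ 2 =
  \sum_(j < n | (j < i)%N)
     T i j * (M j p * M i q + M j q * M i p + S q p * (M j q * M i q)).

Lemma comp_relator T M i : relator T i \mPo lsubst M =
  lform (M i) ^+ 2 - \sum_(j < n | (j < i)%N) T i j *: (lform (M j) * lform (M i)).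
Proof.
rewrite /relator rmorphB rmorphXn /= (raddf_sum (comp_mpoly (lsubst M))).
rewrite /= comp_mpolyXU -tnth_nth tnth_mktuple.
congr (_ - _); apply: eq_bigr => j _.
by rewrite linearZ /= rmorphM /= !comp_mpolyXU -!tnth_nth !tnth_mktuple.
Qed.

Lemma lin_morphP T S M :
  lin_morph T S M <-> (forall i, in_relator_ideal S (relator T i \mPo lsubst M)).
Proof.
have lM2 u v : lform u * lform v \is 2.-homog.
  by rewrite (@dhomogM _ _ _ 1 _ 1 _) ?lform_homog.
have hom2 i : relator T i \mPo lsubst M \is 2.-homog.
  by rewrite comp_relator expr2 rpredB ?rpred_sum // => j _; rewrite rpredZ.
have qE i (p q : 'I_n) : (p < q)%N -> qcoef S p q (relator T i \mPo lsubst M) =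
   2 * M i p * M i q + S q p * M i q ^+ 2 - \sum_(j < n | (j < i)%N)
     T i j * (M j p * M i q + M j q * M i p + S q p * (M j q * M i q)).
  move=> lt_pq; have ne_pq : (p == q) = false.
    by apply/negbTE; apply: contraTneq lt_pq => ->; rewrite ltnn.
  rewrite comp_relator /qcoef !mcoeffB expr2 !lformM_mcoeff ne_pq eqxx !(raddf_sum (mcoeff _)) /=.
  rewrite mulrBr mulr_sumr addrACA -opprD -big_split /=.
  congr (_ - _); first by ring.
  by apply: eq_bigr => j _; rewrite !mcoeffZ !lformM_mcoeff ne_pq eqxx; ring.
split=> [MP i|MP i p q lt_pq].
  by apply/qcoef_relator_ideal => // p q lt_pq; rewrite qE // MP // subrr.
by apply/eqP; rewrite -subr_eq0 -qE // (iffLR (qcoef_relator_ideal S (hom2 i))).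
Qed.

(** * From graded isomorphisms to matrices *)

Lemma in_degreeP T d x :
  in_degree (2 * d) x <-> exists2 p, p \is d.-homog & x = presAlg_pi T p.
Proof.
split=> [[p ph ->]|[p /dhomogP ph ->]]; exists p => //.
  by apply/dhomogP=> m /ph /eqP; rewrite eqn_mul2l => /eqP.
by move=> m /ph <-.
Qed.

(** Preservation of degree makes each f(X_i) the class of a linear form, whose coefficients are row
    i of [M]. *)
Lemma presAlg_equiv_lin T S :
  presAlg_equiv T S -> exists2 M, M \in unitmx & lin_morph T S M.
Proof.
case=> f [[g fK _] fdeg].
have fX i : exists v, f (presAlg_pi T 'X_i) = presAlg_pi S (lform v).
  have /fdeg : in_degree (2 * 1) (presAlg_pi T 'X_i).
    by apply/in_degreeP; exists 'X_i; rewrite // dhomogX /= mdeg1.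
  by move/in_degreeP=> [p /homog1_lform -> ->]; eexists.
have {fX}[m fX] := choice fX; pose M := \matrix_(i, j) m i j.
have {}fX i : f (presAlg_pi T 'X_i) = presAlg_pi S (lform (M i)).
  by rewrite fX; congr presAlg_pi; apply: eq_bigr => k _; rewrite mxE.
exists M.
  (* A row vector killed by [M] gives a linear form whose class [f] sends to 0; by injectivity of
     [f] it lies in the ideal, which has no linear part. *)
  rewrite -row_free_unit; apply: inj_row_free => v vM.
  have : f (presAlg_pi T (lform (v 0))) = 0.
    rewrite /lform !raddf_sum /=.
    under eq_bigr => k _ do rewrite presAlg_piZ linearZ /= fX -presAlg_piZ.
    rewrite -raddf_sum; have -> : \sum_k v 0 k *: lform (M k) = lform ((v *m M) 0).
      rewrite /lform; under eq_bigr do rewrite scaler_sumr.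
      rewrite exchange_big; apply: eq_bigr => k _ /=.
      by rewrite mxE scaler_suml; under eq_bigr do rewrite scalerA.
    by rewrite vM /lform big1 ?raddf0 // => k _; rewrite mxE scale0r.
  rewrite -(rmorph0 f) => /(can_inj fK)/presAlg_pi_eq0 v0.
  by apply/rowP=> k; rewrite mxE -lform_mcoeff; apply: relator_ideal_mcoeff1 v0.
apply/lin_morphP=> i; apply/presAlg_pi_eq0.
have : f (presAlg_pi T (relator T i)) = 0.
  rewrite (iffRL (presAlg_pi_eq0 _ _)) ?rmorph0 //.
  exists (fun k => (k == i)%:R); rewrite (bigD1 i) //= eqxx mul1r big1 ?addr0 //.
  by move=> k /negbTE->; rewrite mul0r.
rewrite comp_relator !rmorphB !rmorphXn /= fX => /subr0_eq->.
rewrite !(raddf_sum (@presAlg_pi _ _ _)) (raddf_sum f) -sumrB big1 // => j _.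
by rewrite /= !presAlg_piZ linearZ /= !rmorphM /= !fX subrr.
Qed.

(** * From matrices to graded isomorphisms *)

Lemma presAlg_lin_morph T S M (MP : lin_morph T S M) p :
  in_relator_ideal T p -> in_relator_ideal S (p \mPo lsubst M).
Proof.
case=> c ->; apply/presAlg_pi_eq0.
rewrite (raddf_sum (comp_mpoly _)) raddf_sum big1 //= => i _.
rewrite !rmorphM /= (iffRL (presAlg_pi_eq0 S (relator T i \mPo _))) ?mulr0 //.
by move/lin_morphP: MP; apply.
Qed.

Definition presAlg_map T S M of lin_morph T S M : presAlg T -> presAlg S :=
  fun x => presAlg_pi S (repr x \mPo lsubst M).

(** Two representatives differ by an element of the ideal of [T], which the substitution carries
    into that of [S], so the choice made by [repr] is immaterial. *)
Lemma presAlg_mapE T S M (MP : lin_morph T S M) p :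
  presAlg_map MP (presAlg_pi T p) = presAlg_pi S (p \mPo lsubst M).
Proof.
apply/subr0_eq; rewrite -!rmorphB /=; apply/presAlg_pi_eq0.
apply: (presAlg_lin_morph MP); apply/presAlg_pi_eq0.
by rewrite rmorphB /= /presAlg_pi reprK subrr.
Qed.

Section PresAlgMap.
Variables (T S M : 'M[F]_n) (MP : lin_morph T S M).

Fact presAlg_map_zmod_morphism : zmod_morphism (presAlg_map MP).
Proof.
move=> x y; have [p ->] := presAlg_pi_surj x; have [q ->] := presAlg_pi_surj y.
by rewrite -rmorphB /= !presAlg_mapE !rmorphB.
Qed.

Fact presAlg_map_monoid_morphism : monoid_morphism (presAlg_map MP).
Proof.
split=> [|x y]; first by rewrite -(rmorph1 (presAlg_pi T)) presAlg_mapE !rmorph1.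
have [p ->] := presAlg_pi_surj x; have [q ->] := presAlg_pi_surj y.
by rewrite -rmorphM /= !presAlg_mapE !rmorphM.
Qed.

Fact presAlg_map_scalable : scalable (presAlg_map MP).
Proof.
move=> c x; have [p ->] := presAlg_pi_surj x.
by rewrite -presAlg_piZ !presAlg_mapE comp_mpolyZ presAlg_piZ.
Qed.

HB.instance Definition _ := GRing.isZmodMorphism.Build _ _
  (presAlg_map MP) presAlg_map_zmod_morphism.
HB.instance Definition _ := GRing.isMonoidMorphism.Build _ _
  (presAlg_map MP) presAlg_map_monoid_morphism.
HB.instance Definition _ := GRing.isScalable.Build _ _ _ _
  (presAlg_map MP) presAlg_map_scalable.

Lemma presAlg_map_degree d x : in_degree d x -> in_degree d (presAlg_map MP x).
Proof.
case=> p pd ->; rewrite presAlg_mapE comp_mpolyEX raddf_sum big_seq.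
elim/big_ind: _ => [|_ _ [p1 p1d ->] [p2 p2d ->]|m /pd md].
- by exists 0; [move=> m; rewrite msupp0 | rewrite rmorph0].
- exists (p1 + p2); rewrite ?rmorphD // => m /msuppD_le; rewrite mem_cat.
  by case/orP=> [/p1d|/p2d].
- rewrite -md; apply/in_degreeP; exists (p@_m *: ('X_[m] \mPo lsubst M)) => //.
  rewrite rpredZ // comp_mpolyX mdegE.
  elim/big_ind2: _ => [|d1 p1 d2 p2|i _]; first exact: dhomog1.
    by move=> hp1 hp2; exact: dhomogM.
  by rewrite tnth_mktuple; have := dhomogMn (m i) (lform_homog (M i)); rewrite mul1n.
Qed.
End PresAlgMap.

(** It suffices to follow the generators: the composite sends X_i to the linear form of row i of
    [M *m N]. *)
Lemma presAlg_mapK T S M N (MP : lin_morph T S M) (NP : lin_morph S T N) :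
  M *m N = 1%:M -> cancel (presAlg_map MP) (presAlg_map NP).
Proof.
move=> MN x; have [p ->] := presAlg_pi_surj x; rewrite !presAlg_mapE; congr presAlg_pi.
rewrite [RHS]mpolyE (comp_mpolyEX p) (raddf_sum (comp_mpoly _)) /=.
apply: eq_bigr => m _; rewrite comp_mpolyZ; congr (_ *: _).
rewrite comp_mpolyX rmorph_prod mpolyXE_id; apply: eq_bigr => i _.
rewrite rmorphXn /= !tnth_mktuple comp_lform; congr (_ ^+ _).
have -> : \row_j M i j = row i M by apply/rowP=> j; rewrite !mxE.
rewrite -row_mul MN /lform (bigD1 i) //= !mxE eqxx scale1r big1 ?addr0 // => j ne_ji.
by rewrite !mxE eq_sym (negbTE ne_ji) scale0r.
Qed.

Lemma lin_presAlg_equiv T S M N :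
  M *m N = 1%:M -> lin_morph T S M -> lin_morph S T N -> presAlg_equiv T S.
Proof.
move=> MN MP NP; have fK := presAlg_mapK MP NP MN.
exists (presAlg_map MP); split.
  by exists (presAlg_map NP); last exact: presAlg_mapK (mulmx1C MN).
move=> d x; split; last exact: presAlg_map_degree.
(* Degrees are reflected because the inverse preserves them. *)
by move/(presAlg_map_degree NP); rewrite fK.
Qed.

(** The sum over j < i becomes a full matrix product, so relation i reads u^2 = w u for the linear
    forms u and w given by row i of [M] and of [T *m M]. *)
Lemma lin_morph_strict_lower T S M :
  (forall i j : 'I_n, (i <= j)%N -> T i j = 0) ->
  lin_morph T S M <-> forall i p q : 'I_n, (p < q)%N ->
    2 * M i p * M i q + S q p * M i q ^+ 2 =
    (T *m M) i p * M i q + (T *m M) i q * M i p + S q p * ((T *m M) i q * M i q).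
Proof.
move=> T0; suff sE (i p q : 'I_n) : \sum_(j < n | (j < i)%N)
     T i j * (M j p * M i q + M j q * M i p + S q p * (M j q * M i q)) =
    (T *m M) i p * M i q + (T *m M) i q * M i p + S q p * ((T *m M) i q * M i q).
  by split=> MP i p q lt_pq; rewrite MP ?sE // -sE.
rewrite big_mkcond !mxE !mulr_suml mulr_sumr -!big_split /=; apply: eq_bigr => j _.
by case: ltnP => [_|/T0->]; ring.
Qed.

End QuadraticPart.

Lemma ord4P (P : 'I_4 -> Prop) :
  (forall i, P i) <-> [/\ P 0, P 1, P 2 & P 3].
Proof.
split=> [allP //|[P0 P1 P2 P3] [[|[|[|[|//]]]] lt_i4]].
- by rewrite (_ : Ordinal _ = 0) //; apply: val_inj.
- by rewrite (_ : Ordinal _ = 1) //; apply: val_inj.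
- by rewrite (_ : Ordinal _ = 2) //; apply: val_inj.
- by rewrite (_ : Ordinal _ = 3) //; apply: val_inj.
Qed.

(** * The relations of [matrixC] in coordinates, the indices 0 to 3 standing for X_1 to X_4 *)

Section MatrixC.
Set Implicit Arguments.
Unset Strict Implicit.
Unset Printing Implicit Defensive.
Variable F : fieldType.
Implicit Types (a b : F) (M : 'M[F]_4) (u w : 'I_4 -> F).

(* The equations [u ^+ 2 = w * u] between linear forms over the algebra of
   [matrixC b], one for each basis element [X_i * X_j] with [i < j]. *)
Definition quad_system b u w : Prop :=
  [/\ 2 * u 0 * u 1 = w 0 * u 1 + w 1 * u 0,
      2 * u 0 * u 2 + u 2 ^+ 2 = w 0 * u 2 + w 2 * u 0 + w 2 * u 2,
      2 * u 1 * u 2 + u 2 ^+ 2 = w 1 * u 2 + w 2 * u 1 + w 2 * u 2 &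
   [/\ 2 * u 0 * u 3 + b * u 3 ^+ 2 = w 0 * u 3 + w 3 * u 0 + b * (w 3 * u 3),
      2 * u 1 * u 3 = w 1 * u 3 + w 3 * u 1 &
      2 * u 2 * u 3 + u 3 ^+ 2 = w 2 * u 3 + w 3 * u 2 + w 3 * u 3]].

(** Row i is the image of the factor w in the source relation X_i^2 = w X_i; these factors are 0, 0,
    X_1 + X_2 and a X_1 + X_3. *)
Lemma matrixCM a M i j : (matrixC a *m M) i j =
  nth 0 [:: 0; 0; M 0 j + M 1 j; a * M 0 j + M 2 j] i.
Proof.
rewrite mxE !big_ord_recr big_ord0 /= !mxE /=.
have -> : widen_ord (leqnSn 3) (widen_ord (leqnSn 2) (widen_ord (leqnSn 1) ord_max)) = 0 :> 'I_4.
  exact: val_inj.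
have -> : widen_ord (leqnSn 3) (widen_ord (leqnSn 2) ord_max) = 1 :> 'I_4.
  exact: val_inj.
have -> : widen_ord (leqnSn 3) ord_max = 2 :> 'I_4 by exact: val_inj.
by case: i => [[|[|[|[|//]]]] lt_i4] /=; ring.
Qed.

Lemma lin_morph_matrixC a b M :
  lin_morph (matrixC a) (matrixC b) M <->
  forall i, quad_system b (M i) ((matrixC a *m M) i).
Proof.
split=> [/lin_morph_strict_lower-/(_ (@matrixC_strict_lower _ a)) MP i|MP].
  have e p q := MP i p q.
  move: (e 0 1 isT) (e 0 2 isT) (e 1 2 isT) (e 0 3 isT) (e 1 3 isT) (e 2 3 isT).
  rewrite ![matrixC b _ _]mxE /= !(mul0r, mul1r, addr0) => e01 e02 e12 e03 e13 e23.
  by do !split.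
apply/lin_morph_strict_lower; first exact: matrixC_strict_lower.
move=> i; case: (MP i) => e01 e02 e12 [e03 e13 e23].
apply/ord4P; split; apply/ord4P; split=> // _; rewrite ![matrixC b _ _]mxE /=.
all: by rewrite ?(mul0r, mul1r) ?(mul0r, mul1r) ?addr0.
Qed.

(** * Solutions of the quadratic system, row by row *)

Hypothesis nz2 : 2 != 0 :> F.

(** Used for the images of X_1 and X_2. A nonzero [u 3] would force [u 1], [u 2] and then [u 3]
    itself to vanish; a nonzero [u 2] would equal both -2 [u 0] and -2 [u 1], so its square would be
    4 [u 0 * u 1], which is 0. *)
Lemma quad_system_row0 b u : quad_system b u (fun=> 0) -> 
  [/\ u 2 = 0, u 3 = 0 & u 0 * u 1 = 0].
Proof.
case; rewrite !mul0r !mulr0 !addr0 => e01 e02 e12 [e03 e13 e23].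
have u01 : u 0 * u 1 = 0 by apply: (mulfI nz2); rewrite mulrA e01 mulr0.
have u3 : u 3 = 0.
  apply/eqP; apply: contraT => nz3.
  have u1 : u 1 = 0 by apply: (mulfI nz2); apply: (mulIf nz3); rewrite e13; ring.
  move/eqP: e12; rewrite u1 mulr0 mul0r add0r expf_eq0 /= => /eqP u2.
  by move/eqP: e23; rewrite u2 mulr0 mul0r add0r expf_eq0 /= (negbTE nz3).
split=> //; apply/eqP; apply: contraT => nz2'.
have s a : 2 * a * u 2 + u 2 ^+ 2 = 0 -> u 2 = - (2 * a).
  by move=> e; apply: (mulIf nz2'); apply/subr0_eq; rewrite -[RHS]e; ring.
have e : 4 * (u 0 * u 1) = u 2 ^+ 2.
  by rewrite [in RHS]expr2 {1}(s _ e02) (s _ e12); ring.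
by move: e; rewrite u01 mulr0 => /esym/eqP; rewrite expf_eq0 (negbTE nz2').
Qed.

(** Used for the image of X_3. Again a nonzero [u 3] is contradictory; division by a nonzero [u 2]
    solves for [u 0] and [u 1], and the equation at X_1 X_2 then yields the product formula. *)
Lemma quad_system_row2 b u w : w 2 = 0 -> w 3 = 0 -> quad_system b u w ->
  u 3 = 0 /\ (u 2 = 0 \/ [/\ u 0 = (w 0 - u 2) / 2, u 1 = (w 1 - u 2) / 2 & u 2 ^+ 2 = w 0 * w 1]).
Proof.
move=> w2 w3; case; rewrite w2 w3 !mul0r !mulr0 !addr0 => e01 e02 e12 [e03 e13 e23].
have u3 : u 3 = 0.
  apply/eqP; apply: contraT => nz3.
  have u1 : 2 * u 1 = w 1 by apply: (mulIf nz3).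
  have u2 : u 2 = 0.
    by move/eqP: e12; rewrite u1 -subr_eq0 addrAC subrr add0r expf_eq0 => /eqP.
  by move/eqP: e23; rewrite u2 mulr0 mul0r add0r expf_eq0 /= (negbTE nz3).
split=> //; case: (eqVneq (u 2) 0) => [|nz2']; [by left | right].
have s c d : 2 * c * u 2 + u 2 ^+ 2 = d * u 2 -> c = (d - u 2) / 2.
  move=> e; apply: (mulIf nz2); rewrite divfK //; apply: (mulIf nz2').
  by rewrite mulrBl -e; ring.
split; [exact: s | exact: s |].
apply/subr0_eq; have := e01; rewrite (s _ _ e02) (s _ _ e12) => /eqP.
rewrite -subr_eq0 => /eqP e; apply: (mulIf (invr_neq0 nz2)); rewrite mul0r -e.
by field.
Qed.

(** Used for the image of X_4. The three equations at products with X_4, divided by [u 3], express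
    [w] linearly in [u]; substitution into the other three gives the conclusions, the last one from
    the difference of those at X_1 X_3 and X_2 X_3. *)
Lemma quad_system_row3 b u w : w 3 = 0 -> u 3 != 0 -> quad_system b u w ->
  [/\ w 0 * w 1 = 0, u 3 ^+ 2 = w 2 * (w 2 + 2 * w 1)
    & w 2 != 0 -> b * (w 2 + 2 * w 1) = w 0 - w 1].
Proof.
move=> w3 nz3; case; rewrite w3 !mul0r !mulr0 !addr0 => e01 e02 e12 [e03 e13 e23].
have u1 : w 1 = 2 * u 1 by apply: (mulIf nz3).
have u2 : w 2 = 2 * u 2 + u 3 by apply: (mulIf nz3); rewrite -e23; ring.
have u0 : w 0 = 2 * u 0 + b * u 3 by apply: (mulIf nz3); rewrite -e03; ring.
have e3 : u 3 ^+ 2 = w 2 * (w 2 + 2 * w 1).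
  apply/subr0_eq; move/eqP: e12; rewrite -subr_eq0 => /eqP e.
  by rewrite -[RHS](mulr0 4) -e u1 u2; ring.
split=> //.
  move/eqP: e01; rewrite -subr_eq0 => /eqP e.
  have z : u 1 * b * u 3 + 2 * u 0 * u 1 = 0.
    by rewrite -[RHS]oppr0 -e u0 u1; ring.
  by rewrite u0 u1 -[RHS](mulr0 2) -z; ring.
move=> nzw2; apply: (mulfI nzw2); rewrite mulrCA -e3; apply/subr0_eq.
move/eqP: e02; rewrite -subr_eq0 => /eqP e; move/eqP: e12; rewrite -subr_eq0 => /eqP e'.
by rewrite -[RHS](mulr0 2) -[X in 2 * X](subrr 0) -{1}e -e' u0 u1 u2; ring.
Qed.

(** * Determinant of a block triangular matrix *)

Lemma det_mx22 (A : 'M[F]_2) : \det A = A 0 0 * A 1 1 - A 0 1 * A 1 0.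
Proof.
rewrite (expand_det_row _ 0) !big_ord_recl big_ord0 addr0 /cofactor !det_mx11 !mxE.
rewrite /= expr0 expr1 mul1r mulN1r mulrN.
by congr (A _ _ * A _ _ - A _ _ * A _ _); apply: val_inj.
Qed.

Lemma det_block22 M : M 0 2 = 0 -> M 0 3 = 0 -> M 1 2 = 0 -> M 1 3 = 0 ->
  \det M = (M 0 0 * M 1 1 - M 0 1 * M 1 0) * (M 2 2 * M 3 3 - M 2 3 * M 3 2).
Proof.
move=> M02 M03 M12 M13; have M0 : ursubmx (M : 'M_(2 + 2)) = 0.
  apply/matrixP=> [] [[|[|//]] i2] [[|[|//]] j2]; rewrite !mxE.
  - by rewrite -[RHS]M02; congr (M _ _); apply: val_inj.
  - by rewrite -[RHS]M03; congr (M _ _); apply: val_inj.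
  - by rewrite -[RHS]M12; congr (M _ _); apply: val_inj.
  - by rewrite -[RHS]M13; congr (M _ _); apply: val_inj.
rewrite -[in LHS](submxK (M : 'M_(2 + 2))) M0 (@det_lblock _ 2 2) !det_mx22 !mxE.
by congr ((M _ _ * M _ _ - M _ _ * M _ _) * (M _ _ * M _ _ - M _ _ * M _ _));
  apply: val_inj.
Qed.

(** * Necessity of the condition *)

Lemma square_conclusion a a' c z : c != 0 -> z != 0 ->
  z ^+ 2 = (2 * a + 1) * c ^+ 2 -> a' * ((2 * a + 1) * c) = - (a * c) ->
  nonzero_square (2 * a + 1) /\ a' = - (a / (2 * a + 1)).
Proof.
move=> nzc nzz sq a'E; have tE : 2 * a + 1 = (z / c) ^+ 2.
  by rewrite expr_div_n sq mulfK // expf_neq0.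
have nzt : z / c != 0 by rewrite mulf_neq0 ?invr_neq0.
split; first by exists (z / c).
have nz : 2 * a + 1 != 0 by rewrite tE expf_neq0.
apply: (mulIf nz); rewrite mulNr divfK //; apply: (mulIf nzc).
by rewrite -mulrA a'E mulNr.
Qed.

Lemma matrixC_lin_morph_necessary a a' M :
  a <> a' -> M \in unitmx -> lin_morph (matrixC a) (matrixC a') M ->
  nonzero_square (2 * a + 1) /\ a' = - (a / (2 * a + 1)).
Proof.
move=> ne_aa' unitM /lin_morph_matrixC MP.
have sys i w : (matrixC a *m M) i =1 w -> quad_system a' (M i) w.
  by move=> /funext<-.
have [M02 M03 M0] := quad_system_row0 (sys 0 _ (fun j => matrixCM a M 0 j)).
have [M12 M13 M1] := quad_system_row0 (sys 1 _ (fun j => matrixCM a M 1 j)).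
have /quad_system_row2 := sys 2 _ (fun j => matrixCM a M 2 j).
rewrite /= M02 M03 M12 M13 addr0 => /(_ erefl erefl) [M23 row2].
(* Invertibility now says that the upper left block is invertible and that [M 2 2] and [M 3 3] are
   nonzero; this rules out the alternative [M 2 2 = 0]. *)
move: unitM; rewrite unitmxE unitfE det_block22 // M23 mul0r subr0.
rewrite !mulf_eq0 !negb_or => /and3P[nzD nz22 nz33].
case: row2 => [/eqP|[M20 M21 M22]]; first by rewrite (negbTE nz22).
have /quad_system_row3 := sys 3 _ (fun j => matrixCM a M 3 j).
rewrite /= M03 M23 M02 mulr0 !add0r => /(_ erefl nz33)[w01 sq /(_ nz22)].
move: w01 sq; rewrite M20 M21 {M20 M21} => w01 sq a'E.
set c := M 2 2 in nz22 M22 w01 sq a'E; set z := M 3 3 in nz33 sq.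
(* By [M0] and [M1] each row of the invertible upper left block has only one nonzero entry, so the
   block is diagonal or antidiagonal. *)
have [[M01 M10]|[M00 M11]] : (M 0 1 = 0 /\ M 1 0 = 0) \/ (M 0 0 = 0 /\ M 1 1 = 0).
  have [M00|nz00] := eqVneq (M 0 0) 0.
    move: nzD; rewrite M00 mul0r sub0r oppr_eq0 mulf_eq0 negb_or => /andP[_ nz10].
    by right; split=> //; apply: (mulfI nz10); rewrite mulr0.
  have M01 : M 0 1 = 0 by apply: (mulfI nz00); rewrite mulr0.
  move: nzD; rewrite M01 mul0r subr0 mulf_eq0 negb_or => /andP[_ nz11].
  by left; split=> //; apply: (mulIf nz11); rewrite mul0r.
(* Lines fixed: vanishing of the first factor in [w01] gives the condition; vanishing of the second
   forces al = be = c and a' = a. *)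
- move: nzD M22 w01 sq a'E; rewrite M01 M10 mul0r subr0 mulr0 !addr0 !add0r.
  rewrite mulf_eq0 negb_or; set al := M 0 0; set be := M 1 1.
  move=> /andP[nzal nzbe] c2 /eqP; rewrite mulf_eq0 => /orP[]/eqP w0 sq a'E.
    have cE : c = (2 * a + 1) * al.
      by apply/subr0_eq; rewrite -[RHS](mulr0 (- 2)) -w0; field.
    have beE : be = (2 * a + 1) * c.
      by apply: (mulfI nzal); rewrite -c2 expr2 {1}cE; ring.
    apply: (@square_conclusion _ _ c z) => //; first by rewrite sq beE; field.
    have -> : (2 * a + 1) * c = c + 2 * ((be - c) / 2) by rewrite -beE; field.
    by rewrite a'E w0 beE; field.
  have beE : be = c by apply/subr0_eq; rewrite -[RHS](mulr0 2) -w0; field.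
  have alE : al = c by apply: (mulIf nzbe); rewrite -c2 beE expr2.
  case: ne_aa'; apply: (mulIf nz22); move: a'E; rewrite beE alE => a'E.
  by move: a'E; rewrite !subrr mul0r mulr0 !addr0 subr0.
(* Lines exchanged: vanishing of the first factor forces al = be = c and gives the condition;
   vanishing of the second gives a' = a. *)
- move: nzD M22 w01 sq a'E; rewrite M00 M11 mul0r sub0r mulr0 !addr0 !add0r.
  rewrite oppr_eq0 mulf_eq0 negb_or; set al := M 1 0; set be := M 0 1.
  move=> /andP[nzbe nzal] c2 /eqP; rewrite mulf_eq0 => /orP[]/eqP w0 sq a'E.
    have alE : al = c by apply/subr0_eq; rewrite -[RHS](mulr0 2) -w0; field.
    have beE : be = c by apply: (mulfI nzal); rewrite -c2 alE expr2.
    apply: (@square_conclusion _ _ c z) => //; first by rewrite sq beE; field.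
    have -> : (2 * a + 1) * c = c + 2 * (a * be + (be - c) / 2) by rewrite beE; field.
    by rewrite a'E alE beE; field.
  have cE : c = (2 * a + 1) * be.
    by apply/subr0_eq; rewrite -[RHS](mulr0 (- 2)) -w0; field.
  have alE : al = (2 * a + 1) * c.
    by apply: (mulIf nzbe); rewrite -c2 expr2 {1}cE; ring.
  case: ne_aa'; apply: (mulIf nz22); apply/esym; move: a'E.
  by rewrite w0 mulr0 addr0 subr0 alE -/c => ->; field.
Qed.

(* The linear map exchanging [X_1] and [X_2] and fixing [X_3]; its value at
   [X_4] is a root of [X ^+ 2 = (X_3 + a * X_2) * X], where [s ^+ 2 = 2 * a + 1]. *)
Definition swap_mx s : 'M[F]_4 :=
  \matrix_(i < 4, j < 4)
    nth 0 (nth [::] [:: [:: 0; 1; 0; 0];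
                        [:: 1; 0; 0; 0];
                        [:: 0; 0; 1; 0];
                        [:: (s ^+ 2 - 1) / 2 / (2 * s); (s ^+ 2 - 1) / 2 / 2;
                            (1 - s) / 2; s]] i) j.

(** With 2a + 1 = s^2 and a' = - a / (2a + 1) one has 2a' + 1 = s^-2, so the inverse is the same
    construction started from a'. *)
Lemma swap_mxV s : s != 0 -> swap_mx s *m swap_mx s^-1 = 1%:M.
Proof.
move=> nzs; apply/matrixP=> i; apply/ord4P; split; move: i; apply/ord4P; split.
all: rewrite !mxE !big_ord_recr big_ord0 /= !mxE /=.
all: field; rewrite ?nzs ?nz2 //.
Qed.

Lemma swap_lin_morph s : s != 0 ->
  lin_morph (matrixC ((s ^+ 2 - 1) / 2)) (matrixC ((s^-1 ^+ 2 - 1) / 2)) (swap_mx s).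
Proof.
move=> nzs; apply/lin_morph_matrixC/ord4P; split; rewrite /quad_system !matrixCM /= !mxE /=.
all: do !split; field; rewrite ?nzs ?nz2 //.
Qed.

End MatrixC.

Theorem proposition2p10 (F : fieldType) (charF : 2%N \notin [pchar F])
    (a a' : F) (neq_aa' : a <> a') :
  presAlg_equiv (matrixC a) (matrixC a') <->
  nonzero_square (2 * a + 1) /\ a' = - (a / (2 * a + 1)).
Proof.
have nz2 : 2 != 0 :> F by move: charF; rewrite inE.
split=> [/presAlg_equiv_lin[M]|[[s nzs tE] ->]]; first exact: matrixC_lin_morph_necessary.
(* Both parameters are written in terms of [s], so that inverting [s] exchanges them and one lemma
   serves both directions. *)
have aE : a = (s ^+ 2 - 1) / 2 by rewrite -tE; field.
have -> : - (a / (2 * a + 1)) = (s^-1 ^+ 2 - 1) / 2 by rewrite tE aE; field; rewrite nz2 nzs.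
rewrite aE; apply: (lin_presAlg_equiv (swap_mxV nz2 nzs)); first exact: swap_lin_morph.
by have := swap_lin_morph nz2 (invr_neq0 nzs); rewrite invrK.
Qed.
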